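(* Let $\rho>0$ and let $(\beta_n)_{n\ge 1}\subseteq(0,1]$. Set $\beta_0=0$, $d_0=0$, $c_0=0$, $R_0=1$ and define recursively, for all $n\ge 1$, $$d_n=|\beta_{n-1}-\beta_n|+\min\{\beta_{n-1},\beta_n\}\,c_{n-1},\qquad c_n=\min\{1,\rho\,d_n\},\qquad R_n=1-\beta_n(1-c_n).$$ (i) Let $T\in\mathrm{Lip}(\rho)$, $T:C\to C$, let $(x^n)_{n\in\mathbb N}$ be the Halpern iterates of $T$ with parameters $(\beta_n)$ started from $x^0\in C$, and suppose that for some $\kappa$ one has $\|Tx^m-Tx^n\|\le\kappa$ for all $m,n\in\mathbb N\cup\{-1\}$ (with the convention $Tx^{-1}=x^0$). Then $\|x^n-x^{n-1}\|\le\kappa\,d_n$ for all $n\ge 1$, and $\|x^n-Tx^n\|\le\kappa\,R_n$ for all $n\in\mathbb N$. (ii) These bounds are tight: for every $\rho>0$, every $\kappa>0$ and every such sequence $(\beta_n)$, there exist a map $T\in\mathrm{Lip}(\rho)$ and a Halpern sequence $(x^n)_{n\in\mathbb N}$ for $T$ with parameters $(\beta_n)$ such that $\|Tx^m-Tx^n\|\le\kappa$ for all $m,n\in\mathbb N\cup\{-1\}$, and $\|x^n-x^{n-1}\|=\kappa\,d_n$ and $\|x^n-Tx^n\|=\kappa\,R_n$ for all $n\ge 1$.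
   Context: $\mathbb N=\{0,1,2,\dots\}$. For $\rho>0$, $\mathrm{Lip}(\rho)$ is the class of all maps $T:C\to C$, where $C$ is a nonempty convex subset (not necessarily bounded or closed) of an arbitrary real normed space $(X,\|\cdot\|)$ (not necessarily complete), such that $\|Tx-Ty\|\le\rho\|x-y\|$ for all $x,y\in C$. Given parameters $(\beta_n)_{n\ge1}$ and $x^0\in C$, the Halpern iterates are $x^n=(1-\beta_n)x^0+\beta_n\,Tx^{n-1}$ for $n\ge 1$. *)

(* Defs.v *)
From mathcomp Require Import all_boot all_order all_algebra.
From mathcomp Require Import all_classical all_reals all_analysis.

Set Implicit Arguments.
Unset Strict Implicit.
Unset Printing Implicit Defensive.

Import Order.TTheory GRing.Theory Num.Theory.
Import numFieldNormedType.Exports.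

Local Open Scope classical_set_scope.
Local Open Scope ring_scope.

(* A map C -> C is represented by a total function on X that preserves C; its
   values outside of C are irrelevant. *)
Definition Lip (R : realType) (rho : R) (X : normedModType R)
    (C : set X) (T : X -> X) : Prop :=
  [/\ C !=set0, convex_set C, set_fun C C T & rho.-lipschitz_C T].

Fixpoint halpern (R : realType) (X : normedModType R) (beta : nat -> R)
    (T : X -> X) (x0 : X) (n : nat) : X :=
  if n is m.+1
  then (1 - beta m.+1) *: x0 + beta m.+1 *: T (halpern beta T x0 m)
  else x0.

(* The sequence (T x^{n-1})_n with the convention T x^{-1} = x^0: indices are
   shifted by one, so that index 0 here stands for -1. *)
Definition halpern_image (R : realType) (X : normedModType R)
    (beta : nat -> R) (T : X -> X) (x0 : X) (n : nat) : X :=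
  if n is m.+1 then T (halpern beta T x0 m) else x0.

(* The pair (d_n, c_n). *)
Fixpoint dc (R : realType) (rho : R) (beta : nat -> R) (n : nat) : R * R :=
  if n is m.+1 then
    let d := `|beta m - beta m.+1|
             + Num.min (beta m) (beta m.+1) * (dc rho beta m).2 in
    (d, Num.min 1 (rho * d))
  else (0, 0).

Definition d_ (R : realType) (rho : R) (beta : nat -> R) (n : nat) : R :=
  (dc rho beta n).1.

Definition c_ (R : realType) (rho : R) (beta : nat -> R) (n : nat) : R :=
  (dc rho beta n).2.

Definition R_ (R : realType) (rho : R) (beta : nat -> R) (n : nat) : R :=
  if n is m.+1 then 1 - beta m.+1 * (1 - c_ rho beta m.+1) else 1.

(* Main.v *)
(* Upper bounds: writing x^n = (1 - beta_n) x^0 + beta_n T x^{n-1}, two iterates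
   differ by |beta_m - beta_n| times a vector of norm at most kappa, plus
   min(beta_m, beta_n) times T x^{m-1} - T x^{n-1}; iterate the Lipschitz bound.

   Tightness: turning all these inequalities into equalities defines recursively
   a function delta on pairs of naturals, which is a pseudometric bounded by 1.
   Its Kuratowski embedding y_n = kappa delta(n, .) into l^oo realizes the
   candidate points T x^{n-1}; the extremal distances are then read off in a
   single coordinate.  The assignment x^n |-> y_{n+1} is rho-Lipschitz by
   construction and extends to all of l^oo by McShane's formula in each
   coordinate, so C can be the whole space. *)
From HB Require Import structures.
Require Import Defs.
From mathcomp Require Import all_boot all_order all_algebra.
From mathcomp Require Import all_classical all_reals all_analysis.
From mathcomp Require Import ring lra.

Set Implicit Arguments.
Unset Strict Implicit.
Unset Printing Implicit Defensive.

Import Order.TTheory GRing.Theory Num.Theory.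
Import numFieldNormedType.Exports.

Local Open Scope classical_set_scope.
Local Open Scope ring_scope.

(** * The space l^oo of bounded sequences and Lipschitz maps into it *)

Definition bounded_seq (R : realType) : {pred nat -> R^o} :=
  [pred u | `[< exists M : R, forall k, `|u k : R| <= M >]].

Lemma bounded_seqP (R : realType) (u : nat -> R^o) :
  reflect (exists M : R, forall k, `|u k : R| <= M) (u \in @bounded_seq R).
Proof. by apply: (iffP idP) => [/asboolP|?] //; apply/asboolP. Qed.

(** A subtype, so that the module structure is inherited from [nat -> R^o]. *)
Record linf (R : realType) :=
  Linf { linf_val : nat -> R^o ; linf_valP : linf_val \in @bounded_seq R }.

HB.instance Definition _ (R : realType) := [isSub for @linf_val R].
HB.instance Definition _ (R : realType) := [Choice of linf R by <:].

Lemma bounded_seq_submod_closed (R : realType) :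
  submod_closed (@bounded_seq R).
Proof.
split=> [|a u v /bounded_seqP[M uM] /bounded_seqP[N vN]].
  by apply/bounded_seqP; exists 0 => k; rewrite normr0.
apply/bounded_seqP; exists (`|a| * M + N) => k.
by rewrite (le_trans (ler_normD _ _))// lerD// normrM ler_wpM2l.
Qed.

HB.instance Definition _ (R : realType) :=
  GRing.isSubmodClosed.Build R (nat -> R^o) (@bounded_seq R)
    (@bounded_seq_submod_closed R).
HB.instance Definition _ (R : realType) :=
  [SubChoice_isSubLmodule of linf R by <:].

(* Valued in [R] rather than [R^o], so that [ring] and [lra] recognize the
   operations. *)
Definition linf_nth (R : realType) (u : linf R) (k : nat) : R := val u k.

Lemma linf_nthD (R : realType) (u v : linf R) k :
  linf_nth (u + v) k = linf_nth u k + linf_nth v k.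
Proof. by []. Qed.

Lemma linf_nthB (R : realType) (u v : linf R) k :
  linf_nth (u - v) k = linf_nth u k - linf_nth v k.
Proof. by []. Qed.

Lemma linf_nthZ (R : realType) a (u : linf R) k :
  linf_nth (a *: u) k = a * linf_nth u k.
Proof. by []. Qed.

Lemma linf_nth_inj (R : realType) (u v : linf R) :
  (forall k, linf_nth u k = linf_nth v k) -> u = v.
Proof. by move=> uv; apply/val_inj/funext. Qed.

Definition linf_norm (R : realType) (u : linf R) : R :=
  sup [set `|linf_nth u k| | k in setT].

Lemma linf_norm_ge (R : realType) (u : linf R) k : `|linf_nth u k| <= linf_norm u.
Proof.
apply: ub_le_sup; last by exists k.
have /bounded_seqP[M uM] := linf_valP u; exists M => _ [j _ <-]; exact: uM.
Qed.

Lemma linf_norm_le (R : realType) (u : linf R) M :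
  (forall k, `|linf_nth u k| <= M) -> linf_norm u <= M.
Proof.
move=> uM; apply: ge_sup => [|_ [k _ <-]//].
by exists `|linf_nth u 0%N|; exists 0%N.
Qed.

Lemma linf_normD (R : realType) (u v : linf R) :
  linf_norm (u + v) <= linf_norm u + linf_norm v.
Proof.
apply: linf_norm_le => k.
by rewrite linf_nthD (le_trans (ler_normD _ _))// lerD// linf_norm_ge.
Qed.

(** Scaling [a *: u] back by [a^-1] turns the upper bound into the lower one. *)
Lemma linf_normZ (R : realType) (a : R) (u : linf R) :
  linf_norm (a *: u) = `|a| * linf_norm u.
Proof.
have le_normZ b v : linf_norm (b *: v) <= `|b| * linf_norm v.
  by apply: linf_norm_le => k; rewrite linf_nthZ normrM ler_wpM2l// linf_norm_ge.
apply/le_anti; rewrite le_normZ /=.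
have [->|a0] := eqVneq a 0.
  rewrite normr0 mul0r (le_trans (normr_ge0 (linf_nth (0 *: u) 0%N)))//.
  exact: linf_norm_ge.
rewrite -ler_pdivlMl ?normr_gt0// -normfV.
by rewrite -[X in linf_norm X <= _](scalerK a0) le_normZ.
Qed.

Lemma linf_norm_eq0 (R : realType) (u : linf R) : linf_norm u = 0 -> u = 0.
Proof.
move=> u0; apply/linf_nth_inj => k; apply/normr0_eq0/le_anti.
by rewrite normr_ge0 -u0 linf_norm_ge.
Qed.

HB.instance Definition _ (R : realType) := Lmodule_isNormed.Build R (linf R)
  (@linf_normD R) (@linf_normZ R) (@linf_norm_eq0 R).

Lemma linf_normP (R : realType) (u : linf R) M :
  reflect (forall k, `|linf_nth u k| <= M) (`|u| <= M).
Proof.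
apply: (iffP idP) => [uM k|]; last exact: linf_norm_le.
exact: le_trans (linf_norm_ge u k) uM.
Qed.

Lemma linf_nth_le_norm (R : realType) (u : linf R) k : `|linf_nth u k| <= `|u|.
Proof. exact: linf_norm_ge. Qed.

Lemma linf_nthB_le (R : realType) (u v : linf R) k :
  linf_nth u k - linf_nth v k <= `|u - v|.
Proof. by rewrite -linf_nthB (le_trans (ler_norm _))// linf_nth_le_norm. Qed.

(* McShane's extension formula, applied in each coordinate. *)
Lemma linf_lipschitz_extension (R : realType) (X : normedModType R) (rho : R)
    (x : nat -> X) (y : nat -> linf R) : 0 <= rho ->
  (forall m n, `|y m - y n| <= rho * `|x m - x n|) ->
  exists T : X -> linf R, (forall u v, `|T u - T v| <= rho * `|u - v|) /\
    forall n, T (x n) = y n.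
Proof.
move=> rho0 yx.
pose S z k : set R := [set linf_nth (y n) k + rho * `|z - x n| | n in setT].
have rhoD z w n : rho * `|z - x n| <= rho * `|w - x n| + rho * `|z - w|.
  by rewrite -mulrDr ler_wpM2l// [leRHS]addrC ler_distD.
have S_n0 z k : S z k !=set0.
  by exists (linf_nth (y 0%N) k + rho * `|z - x 0%N|); exists 0%N.
(* The Lipschitz hypothesis on the data bounds [S z k] from below, so that its infimum is
   meaningful. *)
have S_lb z k m : lbound (S z k) (linf_nth (y m) k - rho * `|z - x m|).
  move=> _ [n _ <-]; have := linf_nthB_le (y m) (y n) k.
  move=> h; rewrite lerBlDr -addrA -lerBlDl; apply: le_trans h _.
  by rewrite (le_trans (yx m n))// (le_trans (rhoD _ z _))// (distrC (x m)) addrC.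
have S_inf z k n : inf (S z k) <= linf_nth (y n) k + rho * `|z - x n|.
  by apply: ge_inf; [exists (linf_nth (y 0%N) k - rho * `|z - x 0%N|)|exists n].
have inf_S z k m : linf_nth (y m) k - rho * `|z - x m| <= inf (S z k).
  exact: lb_le_inf (S_lb z k m).
(* The bounds coming from index 0 are uniform in [k], so the coordinatewise infima form a bounded
   sequence. *)
have bS z : (fun k => inf (S z k)) \in @bounded_seq R.
  apply/bounded_seqP; exists (`|y 0%N| + rho * `|z - x 0%N|) => k.
  have := inf_S z k 0%N; have := S_inf z k 0%N.
  have := linf_nth_le_norm (y 0%N) k.
  rewrite !ler_norml => /andP[? ?] ? ?; apply/andP; split; lra.
have lipS z w k : inf (S z k) <= inf (S w k) + rho * `|z - w|.
  rewrite -lerBlDr; apply: lb_le_inf => // _ [n _ <-].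
  by have := S_inf z k n; have := rhoD z w n; lra.
exists (fun z => Linf (bS z)); split=> [u v|n].
  apply/linf_normP => k; rewrite linf_nthB ler_norml.
  have := lipS u v k; have := lipS v u k; rewrite (distrC v u) /=.
  move=> ? ?; apply/andP; split; lra.
(* At the point [x n], the bounds [S_inf] and [inf_S] of index [n] coincide. *)
apply/linf_nth_inj => k; apply/le_anti.
have := S_inf (x n) k n; have := inf_S (x n) k n.
by rewrite subrr normr0 mulr0 addr0 subr0 => -> ->.
Qed.

(** * Convex combinations with a common base point, and the extremal pseudometric *)

Lemma dist_conv_le (R : realType) (X : normedModType R) (x u v : X)
    (a b kappa : R) : 0 <= a -> 0 <= b ->
  `|u - x| <= kappa -> `|v - x| <= kappa ->
  `|((1 - a) *: x + a *: u) - ((1 - b) *: x + b *: v)|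
    <= kappa * `|a - b| + Num.min a b * `|u - v|.
Proof.
wlog ab : a b u v / a <= b => [hw a0 b0 ux vx|a0 _ _ vx].
  have [ab|ba] := orP (le_total a b); first exact: hw.
  have := hw b a v u ba b0 a0 vx ux.
  by rewrite minC (distrC b) (distrC v) [X in X <= _]distrC.
have convE c w : (1 - c) *: x + c *: w = x + c *: (w - x).
  by rewrite scalerBl scale1r scalerBr -addrA [- _ + _]addrC.
(* The common weight [a] falls on [u - v], the surplus on [v - x], whose norm is at most [kappa]. *)
have -> : ((1 - a) *: x + a *: u) - ((1 - b) *: x + b *: v) =
    a *: (u - v) + (a - b) *: (v - x).
  rewrite !convE opprD addrACA subrr add0r.
  have -> : u - v = (u - x) - (v - x) by rewrite opprB addrA subrK.
  by move: (u - x) (v - x) => p q; rewrite scalerBr scalerBl addrA subrK.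
rewrite (min_idPl ab) [leRHS]addrC (le_trans (ler_normD _ _))// !normrZ.
by rewrite (ger0_norm a0) lerD2l mulrC ler_wpM2r.
Qed.

(** The bound of [dist_conv_le] for weights [beta m] and [beta n], with [kappa] normalized to 1 and
    [delta m n] as the distance between the images. *)
Definition cost (R : realType) (beta : nat -> R) (delta : nat -> nat -> R) m n :=
  `|beta m - beta n| + Num.min (beta m) (beta n) * delta m n.

(* Indices are shifted as in [halpern_image]: [delta m n] prescribes the
   distance between [T x^{m-1}] and [T x^{n-1}]. *)
Fixpoint delta (R : realType) (rho : R) (beta : nat -> R) (m n : nat) : R :=
  match m, n with
  | 0%N, 0%N => 0
  | m'.+1, n'.+1 => Num.min 1
      (rho * (`|beta m' - beta n'|
              + Num.min (beta m') (beta n') * delta rho beta m' n'))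
  | _, _ => 1
  end.

Lemma deltaSS (R : realType) (rho : R) (beta : nat -> R) m n :
  delta rho beta m.+1 n.+1 = Num.min 1 (rho * cost beta (delta rho beta) m n).
Proof. by []. Qed.

(* [|a - c| + min a c * r] is the Wasserstein distance between
   [(1 - a) 0 + a m] and [(1 - c) 0 + c n] when 0 lies at distance 1 from [m]
   and [n], and [r] is the distance between these two. *)
Lemma cost_triangle (R : realType) (a b c p q r : R) :
  0 <= a -> 0 <= b -> 0 <= c -> 0 <= p -> 0 <= q -> r <= p + q -> r <= 1 ->
  `|a - c| + Num.min a c * r
    <= (`|a - b| + Num.min a b * p) + (`|b - c| + Num.min b c * q).
Proof.
move=> a0 b0 c0 p0 q0 rpq r1.
wlog ac : a c p q a0 c0 p0 q0 rpq / a <= c => [hw|].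
  have [ac|ca] := orP (le_total a c); first exact: hw.
  rewrite [leRHS]addrC (minC a c) (minC a b) (minC b c).
  by rewrite (distrC a c) (distrC a b) (distrC b c); apply: hw; rewrite 1?addrC.
rewrite (min_idPl ac) (distrC a) (ger0_norm (_ : 0 <= c - a)) ?subr_ge0//.
have [bc|cb] := orP (le_total b c); rewrite ?(min_idPl bc) ?(min_idPr cb).
  rewrite (distrC b) (ger0_norm (_ : 0 <= c - b)) ?subr_ge0//.
  have [ab|/ltW ba] := leP a b.
    rewrite distrC ger0_norm ?subr_ge0//; nra.
  (* Here [b <= a]: the weight [a - b] is handled by [r <= 1], the weight [b] by [r <= p + q]. *)
  rewrite ger0_norm ?subr_ge0//; nra.
rewrite (ger0_norm (_ : 0 <= b - c)) ?subr_ge0//.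
have ab := le_trans ac cb.
rewrite (min_idPl ab) distrC ger0_norm ?subr_ge0//; nra.
Qed.

Section delta.
Context (R : realType) (rho : R) (beta : nat -> R).
Hypotheses (rho_ge0 : 0 <= rho) (beta_ge0 : forall n, 0 <= beta n).
Local Notation delta := (delta rho beta).
Local Notation cost := (cost beta delta).

Lemma delta_le1 m n : delta m n <= 1.
Proof. by case: m n => [|m] [|n] //; rewrite deltaSS ge_min lexx. Qed.

Lemma delta_ge0 m n : 0 <= delta m n.
Proof.
elim: m n => [|m IHm] [|n] //; rewrite deltaSS le_min ler01/=.
by rewrite mulr_ge0// addr_ge0// mulr_ge0// le_min !beta_ge0.
Qed.

Lemma deltaxx n : delta n n = 0.
Proof.
elim: n => [|n IHn] //; rewrite deltaSS /cost IHn subrr normr0 mulr0 addr0.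
by rewrite mulr0; apply/min_idPr.
Qed.

Lemma deltaC m n : delta m n = delta n m.
Proof.
by elim: m n => [|m IHm] [|n] //; rewrite !deltaSS /cost IHm distrC (minC (beta m)).
Qed.

(** Induction lowering all three indices at once: [cost_triangle] carries the inequality from
    [delta] to [cost], and scaling by [rho] and truncating at 1 preserve it. If some index is 0, it
    suffices that 0 is at distance 1, the largest value, from all other indices. *)
Lemma delta_triangle k m n : delta m n <= delta m k + delta k n.
Proof.
have d0 := delta_ge0; have d1 := delta_le1.
elim: m k n => [|m IHm] [|k] [|n]; rewrite ?deltaxx ?add0r ?addr0 ?addr_ge0//.
- by rewrite -[leLHS]addr0 lerD.
- by rewrite (le_trans (d1 _ _))// -[leLHS]addr0 lerD.
- by rewrite -[leLHS]add0r lerD.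
have := cost_triangle (beta_ge0 m) (beta_ge0 k) (beta_ge0 n) (d0 m k) (d0 k n)
  (IHm k n) (d1 m n).
rewrite !deltaSS -!/(cost _ _) => h.
have c0 i j : 0 <= rho * cost i j.
  by rewrite mulr_ge0// addr_ge0// mulr_ge0// le_min !beta_ge0.
have := ler_wpM2l rho_ge0 h; rewrite mulrDr => {}h.
have := c0 m k; have := c0 k n; have := c0 m n.
rewrite ge_min; case: (lerP 1 (rho * cost m k)); case: (lerP 1 (rho * cost k n)).
all: move=> *; apply/orP; first [left; lra|right; lra].
Qed.
End delta.

(** * Upper bounds for Halpern iterates *)

Lemma dist_conv_point_le (R : realType) (X : normedModType R) (x u w : X)
    (a : R) : 0 <= a <= 1 ->
  `|((1 - a) *: x + a *: u) - w| <= (1 - a) * `|x - w| + a * `|u - w|.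
Proof.
move=> /andP[a0 a1].
have -> : ((1 - a) *: x + a *: u) - w = (1 - a) *: (x - w) + a *: (u - w).
  by rewrite !scalerBr addrACA -opprD -scalerDl subrK scale1r.
rewrite (le_trans (ler_normD _ _))// !normrZ (ger0_norm a0) ger0_norm//.
by rewrite subr_ge0.
Qed.

(** The convention [beta 0 = 0] lets one formula cover the starting point too. *)
Lemma halpernE (R : realType) (X : normedModType R) (beta : nat -> R)
    (T : X -> X) (x0 : X) : beta 0%N = 0 -> forall n,
  halpern beta T x0 n
    = (1 - beta n) *: x0 + beta n *: halpern_image beta T x0 n.
Proof. by move=> b0 [|n] //=; rewrite b0 subr0 scale1r scale0r addr0. Qed.

Lemma halpern_mem (R : realType) (X : normedModType R) (beta : nat -> R)
    (C : set X) (T : X -> X) (x0 : X) : (forall n, 0 <= beta n <= 1) ->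
  convex_set C -> set_fun C C T -> C x0 -> forall n, C (halpern beta T x0 n).
Proof.
move=> b01 cC TC Cx0; elim=> [|n IHn] //=.
have /andP[b0 b1] := b01 n.+1.
have := cC (T (halpern beta T x0 n)) x0 (Itv01 b0 b1).
by rewrite !inE addrC; apply => //; exact: TC.
Qed.

(** On consecutive indices the recursion for [delta] becomes the one for [dc]. *)
Lemma delta_succ (R : realType) (rho : R) (beta : nat -> R) :
  beta 0%N = 0 -> (forall n, 0 <= beta n) -> forall n,
  cost beta (delta rho beta) n n.+1 = d_ rho beta n.+1 /\
  delta rho beta n.+1 n.+2 = c_ rho beta n.+1.
Proof.
move=> b0 b_ge0; have cost_c n :
    cost beta (delta rho beta) n n.+1 = d_ rho beta n.+1 ->
    delta rho beta n.+1 n.+2 = c_ rho beta n.+1.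
  by rewrite deltaSS => ->.
elim=> [|n [_ IHn]]; (split; last apply: cost_c).
(* The values [delta 0 1 = 1] and [c_0 = 0] differ, but both are multiplied by a minimum that
   vanishes with [beta 0]. *)
- by rewrite /cost /d_ /= b0 (min_idPl (b_ge0 1%N)) !mul0r.
- by rewrite /cost /d_ /= b0 (min_idPl (b_ge0 1%N)) !mul0r.
- by rewrite /cost IHn.
- by rewrite /cost IHn.
Qed.

Lemma halpern_upper_bounds (R : realType) (rho : R) (beta : nat -> R)
    (X : normedModType R) (C : set X) (T : X -> X) (x0 : X) (kappa : R) :
  0 <= rho -> beta 0%N = 0 -> (forall n, 0 <= beta n <= 1) ->
  Lip rho C T -> C x0 ->
  (forall m n, `|halpern_image beta T x0 m - halpern_image beta T x0 n|
    <= kappa) ->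
  (forall n, `|halpern beta T x0 n.+1 - halpern beta T x0 n|
    <= kappa * d_ rho beta n.+1) /\
  (forall n, `|halpern beta T x0 n - T (halpern beta T x0 n)|
    <= kappa * R_ rho beta n).
Proof.
move=> rho0 b0 b01 [_ cC TC lipT] Cx0 bT.
pose x n := halpern beta T x0 n; pose y n := halpern_image beta T x0 n.
have b_ge0 n : 0 <= beta n by have /andP[] := b01 n.
have xE n : x n = (1 - beta n) *: x0 + beta n *: y n by exact: halpernE.
have Cx n : C (x n) by exact: halpern_mem.
have kappa0 : 0 <= kappa by exact: le_trans (normr_ge0 _) (bT 0%N 0%N).
have lipx n : `|y n.+2 - y n.+1| <= rho * `|x n.+1 - x n|.
  exact: (lipT (x n.+1, x n) (conj (Cx _) (Cx _))).
have stepx n : `|x n.+1 - x n|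
    <= kappa * `|beta n - beta n.+1|
       + Num.min (beta n) (beta n.+1) * `|y n.+1 - y n|.
  rewrite [leLHS]distrC (distrC (y _)) !xE.
  exact: dist_conv_le (bT n 0%N) (bT n.+1 0%N).
have step n : `|x n.+1 - x n| <= kappa * d_ rho beta n.+1 /\
    `|y n.+2 - y n.+1| <= kappa * c_ rho beta n.+1.
  (* The two arguments of the minimum in [c_] come from the bound [kappa] on the images and from the
     Lipschitz condition. *)
  have cd k : `|x k.+1 - x k| <= kappa * d_ rho beta k.+1 ->
      `|y k.+2 - y k.+1| <= kappa * c_ rho beta k.+1.
    move=> dk; rewrite [c_ _ _ _]/(Num.min 1 (rho * d_ rho beta k.+1)).
    rewrite minr_pMr// mulr1 le_min bT/= (le_trans (lipx k))//.
    by rewrite mulrCA ler_wpM2l.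
  suff dn : `|x n.+1 - x n| <= kappa * d_ rho beta n.+1 by split; last exact: cd.
  elim: n => [|n /cd IHn]; rewrite (le_trans (stepx _))//.
    by rewrite /d_ /= b0 (min_idPl (b_ge0 1%N)) !mul0r !addr0.
  rewrite [d_ _ _ _]/(`|beta n.+1 - beta n.+2| +
    Num.min (beta n.+1) (beta n.+2) * c_ rho beta n.+1) mulrDr lerD2l.
  by rewrite mulrCA ler_wpM2l// le_min !b_ge0.
split=> [n|[|n]]; first by have [] := step n.
  by rewrite mulr1; exact: (bT 0%N 1%N).
(* By convexity, it suffices to bound the distances from [y n.+2], the image of [x n.+1], to [x0]
   and to [y n.+1]. *)
rewrite -/(x n.+1) xE (le_trans (dist_conv_point_le _ _ _ (b01 _)))//.
have [_ yc] := step n; have y0 : `|x0 - y n.+2| <= kappa := bT 0%N n.+2.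
have /andP[bn0 bn1] := b01 n.+1.
rewrite [leRHS](_ : kappa * R_ rho beta n.+1 = (1 - beta n.+1) * kappa +
  beta n.+1 * (kappa * c_ rho beta n.+1)); last by rewrite /R_; ring.
by rewrite lerD// ler_wpM2l// ?subr_ge0// distrC.
Qed.

(** * The extremal sequence in l^oo *)

Section tight.
Context (R : realType) (rho : R) (beta : nat -> R) (kappa : R).
Hypotheses (rho_ge0 : 0 <= rho) (kappa_ge0 : 0 <= kappa).
Hypotheses (beta0 : beta 0%N = 0) (beta01 : forall n, 0 <= beta n <= 1).
Local Notation delta := (delta rho beta).
Local Notation cost := (cost beta delta).

Let beta_ge0 n : 0 <= beta n. Proof. by have /andP[] := beta01 n. Qed.

Lemma delta_row_bounded n :
  (fun k => kappa * delta n k) \in @bounded_seq R.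
Proof.
apply/bounded_seqP; exists kappa => k.
by rewrite normrM !ger0_norm ?delta_ge0// ler_piMr// delta_le1.
Qed.

(* Kuratowski embedding of the pseudometric [kappa * delta]. *)
Definition extremal_image n : linf R := Linf (delta_row_bounded n).
Local Notation y := extremal_image.

(** Defined before any map is available; it has the form that [halpernE] gives to iterates started
    at [y 0]. *)
Definition extremal_seq n : linf R := (1 - beta n) *: y 0 + beta n *: y n.
Local Notation x := extremal_seq.

Lemma delta0S n : delta 0 n.+1 = 1.
Proof. by []. Qed.

Lemma extremal_image_nth n k : linf_nth (y n) k = kappa * delta n k.
Proof. by []. Qed.

Lemma extremal_seq_nth n k : linf_nth (x n) k =
  (1 - beta n) * (kappa * delta 0 k) + beta n * (kappa * delta n k).
Proof. by []. Qed.

Lemma extremal_image_dist m n : `|y m - y n| = kappa * delta m n.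
Proof.
apply/le_anti/andP; split.
  apply/linf_normP => k; rewrite linf_nthB !extremal_image_nth -mulrBr normrM.
  rewrite ger0_norm// ler_wpM2l// ler_norml.
  have := delta_triangle rho_ge0 beta_ge0 n m k.
  have := delta_triangle rho_ge0 beta_ge0 m n k.
  rewrite (deltaC _ _ n m) => ? ?; apply/andP; split; lra.
rewrite (le_trans _ (linf_nthB_le _ _ n))// !extremal_image_nth.
by rewrite deltaxx mulr0 subr0.
Qed.

Lemma extremal_seq_dist m n : `|x m - x n| = kappa * cost m n.
Proof.
apply/le_anti/andP; split.
  have y0 k : `|y k - y 0| <= kappa by rewrite extremal_image_dist ler_piMr// delta_le1.
  rewrite (le_trans (dist_conv_le _ _ (y0 m) (y0 n)))//.
  by rewrite extremal_image_dist mulrDr mulrCA.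
wlog mn : m n / beta m <= beta n => [hw|].
  have [|nm] := orP (le_total (beta m) (beta n)); first exact: hw.
  have := hw _ _ nm.
  rewrite /cost (deltaC _ _ n m) (distrC (x n)) (distrC (beta n)).
  by rewrite (minC (beta n)).
(* The index 0 is set apart since [delta 0 n] is 1 only for positive [n]. *)
case: n mn => [|n] mn.
  have bm0 : beta m = 0 by apply/le_anti; rewrite beta_ge0 -beta0 mn.
  by rewrite /cost bm0 beta0 subrr normr0 (min_idPl _)// mul0r addr0 mulr0.
(* The coordinate of the index with the larger weight attains the norm. *)
rewrite (le_trans _ (linf_nthB_le _ _ n.+1))// !extremal_seq_nth deltaxx.
rewrite /cost (min_idPl mn) distrC ger0_norm ?subr_ge0//.
rewrite le_eqVlt; apply/orP; left; apply/eqP.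
by rewrite delta0S; ring.
Qed.

Lemma extremal_residual n : `|x n - y n.+1| =
  kappa * (1 - beta n * (1 - delta n n.+1)).
Proof.
have -> : kappa * (1 - beta n * (1 - delta n n.+1)) =
    (1 - beta n) * (kappa * delta 0 n.+1) + beta n * (kappa * delta n n.+1).
  by rewrite delta0S; ring.
apply/le_anti/andP; split.
  by rewrite -!extremal_image_dist dist_conv_point_le.
(* The norm is attained at coordinate [n.+1], where [y n.+1] vanishes. *)
rewrite (le_trans _ (linf_nthB_le _ _ n.+1))// extremal_seq_nth extremal_image_nth.
by rewrite deltaxx mulr0 subr0.
Qed.

Lemma extremal_map : exists T : linf R -> linf R,
  (forall u v, `|T u - T v| <= rho * `|u - v|) /\ forall n, T (x n) = y n.+1.
Proof.
apply: linf_lipschitz_extension => // m n.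
rewrite extremal_image_dist extremal_seq_dist deltaSS mulrCA ler_wpM2l//.
by rewrite ge_min lexx orbT.
Qed.

End tight.

Theorem proposition1 (R : realType) (rho : R) (beta : nat -> R)
    (rho_gt0 : 0 < rho) (beta0 : beta 0%N = 0)
    (beta_itv : forall n : nat, (1 <= n)%N -> 0 < beta n <= 1) :
  (forall (X : normedModType R) (C : set X) (T : X -> X) (x0 : X) (kappa : R),
      Lip rho C T -> C x0 ->
      (forall m n : nat,
          `|halpern_image beta T x0 m - halpern_image beta T x0 n| <= kappa) ->
      (forall n : nat, (1 <= n)%N ->
          `|halpern beta T x0 n - halpern beta T x0 n.-1|
            <= kappa * d_ rho beta n) /\
      (forall n : nat,
          `|halpern beta T x0 n - T (halpern beta T x0 n)|
            <= kappa * R_ rho beta n))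
  /\
  (forall kappa : R, 0 < kappa ->
      exists (X : normedModType R) (C : set X) (T : X -> X) (x0 : X),
        [/\ Lip rho C T, C x0,
            (forall m n : nat,
                `|halpern_image beta T x0 m - halpern_image beta T x0 n|
                  <= kappa),
            (forall n : nat, (1 <= n)%N ->
                `|halpern beta T x0 n - halpern beta T x0 n.-1|
                  = kappa * d_ rho beta n)
          & (forall n : nat, (1 <= n)%N ->
                `|halpern beta T x0 n - T (halpern beta T x0 n)|
                  = kappa * R_ rho beta n)]).
Proof.
have beta01 n : 0 <= beta n <= 1.
  case: n => [|n]; first by rewrite beta0 lexx ler01.
  by have /andP[/ltW -> ->] := beta_itv n.+1 isT.
have beta_ge0 n : 0 <= beta n by have /andP[] := beta01 n.
have rho_ge0 := ltW rho_gt0.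
split=> [X C T x0 kappa LT Cx0 bT|kappa /ltW kappa_ge0].
  have [dx dxT] := halpern_upper_bounds rho_ge0 beta0 beta01 LT Cx0 bT.
  by split=> // -[//|n] _; exact: dx.
have [T [lipT Tx]] := extremal_map rho_ge0 kappa_ge0 beta0 beta01.
pose x := extremal_seq rho_ge0 kappa_ge0 beta01.
pose y := extremal_image rho_ge0 kappa_ge0 beta01.
(* Since [T] sends [x n] to [y n.+1], the prescribed sequence solves the Halpern recursion;
   [beta 0 = 0] gives [x 0 = y 0]. *)
have hx n : halpern beta T (y 0%N) n = x n.
  elim: n => [|n IHn] /=; last by rewrite IHn Tx.
  by rewrite /x /extremal_seq beta0 subr0 scale1r scale0r addr0.
have hy n : halpern_image beta T (y 0%N) n = y n.
  by case: n => [|n] //=; rewrite hx Tx.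
exists (linf R), setT, T, (y 0%N); split=> //.
- split; [by exists 0 | by move=> u v l _ _; rewrite inE | by [] |].
  by move=> [u v] _; exact: lipT.
- by move=> m n; rewrite !hy extremal_image_dist// ler_piMr// delta_le1.
- case=> [//|n] _; rewrite !hx distrC extremal_seq_dist//.
  by have [-> _] := delta_succ rho beta0 beta_ge0 n.
- case=> [//|n] _; rewrite !hx Tx extremal_residual//.
  by have [_ ->] := delta_succ rho beta0 beta_ge0 n.
Qed.
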